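(* Let $I$ be a nonempty index set. Assume that the gains $\gamma_{ij}$, $(i,j)\in I^2$, are all linear and that the associated gain operator $\Gamma_\otimes:\ell_\infty^+(I)\to\ell_\infty^+(I)$, $\Gamma_\otimes(s)=(\sup_{j\in I}\gamma_{ij}(s_j))_{i\in I}$, is well-defined. Then the following statements are equivalent: (i) The operator $\mathrm{id}-\Gamma_\otimes$ satisfies the MBI property. (ii) There are $\lambda\in(0,1)$ and $s_0\in\mathrm{int}(\ell_\infty^+(I))$ such that $\Gamma_\otimes(s_0)\le\lambda s_0$. (iii) The spectral radius of $\Gamma_\otimes$ satisfies $$r(\Gamma_\otimes)=\lim_{n\to\infty}\ \sup_{s\in\ell_\infty^+(I),\ \|s\|_{\ell_\infty}=1}\|\Gamma_\otimes^n(s)\|_{\ell_\infty(I)}^{1/n}=\lim_{n\to\infty}\|\Gamma_\otimes^n(\mathbf{1})\|_{\ell_\infty(I)}^{1/n}<1.$$ (iv) The system $x(k+1)\le\Gamma_\otimes(x(k))+u(k)$, $k\in\mathbb{Z}_+$, is eISS. (v) The system $x(k+1)\le\Gamma_\otimes(x(k))+u(k)$, $k\in\mathbb{Z}_+$, has the MLIM property.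
   Context: $\ell_\infty(I)$: bounded functions $I\to\mathbb{R}$ with sup-norm; $X^+:=\ell_\infty^+(I)$: its componentwise nonnegative elements; $\le$ is componentwise; $\mathrm{int}$ is the norm interior; $\mathbf{1}$ is the constant-one vector. Gains are functions $\gamma_{ij}\in\mathcal{K}\cup\{0\}$ with $\gamma_{ii}=0$, where $\mathcal{K}$ is the set of continuous strictly increasing $\gamma:\mathbb{R}_+\to\mathbb{R}_+$ with $\gamma(0)=0$ and $0$ is the zero function; linear gains are $\gamma_{ij}(r)=\gamma_{ij}r$ with constants $\gamma_{ij}\ge0$. Well-definedness of $\Gamma_\otimes$ is equivalent to $\sup_{i,j}\gamma_{ij}(r)<\infty$ for all $r>0$. $\mathcal{K}_\infty$: unbounded functions in $\mathcal{K}$. A solution for input $u$ is a map $x:\mathbb{Z}_+\to X^+$ satisfying the inequality for all $k$. Inputs are sequences $u$ in $X^+$ with $\|u\|_\infty:=\sup_k\|u(k)\|<\infty$. **eISS.** There are $M\ge1$, $a\in(0,1)$, $\gamma\in\mathcal{K}_\infty$ such that for every such input $u$ and any solution $x(\cdot)$: $\|x(k)\|\le M\|x(0)\|a^k+\gamma(\|u\|_\infty)$ for all $k\in\mathbb{Z}_+$. **MLIM.** There is $\xi\in\mathcal{K}_\infty$ such that for every $\varepsilon>0$, every constant input $u(\cdot)\equiv w\in X^+$ and every decreasing solution $x(\cdot)$ ($x(k+1)\le x(k)$ for all $k$) there is $N\in\mathbb{Z}_+$ (depending on $\varepsilon,u,x(\cdot)$) with $\|x(N)\|\le\varepsilon+\xi(\|w\|)$.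 **MBI of $\mathrm{id}-A$.** There is $\xi\in\mathcal{K}_\infty$ such that for all $v,w\in X^+$: $(\mathrm{id}-A)(v)\le w\Rightarrow\|v\|\le\xi(\|w\|)$. *)

(* Defs.v *)
From HB Require Import structures.
From mathcomp Require Export all_boot all_order all_algebra.
From mathcomp Require Export all_classical all_reals all_analysis.
Export Order.TTheory GRing.Theory Num.Theory.
Export numFieldNormedType.Exports.

Set Implicit Arguments.
Unset Strict Implicit.
Unset Printing Implicit Defensive.

Local Open Scope classical_set_scope.
Local Open Scope ring_scope.

(* A map R_+ -> R_+ is represented by a function R -> R of which only the
   values on [0, +oo[ matter. Likewise, an operator on the cone linfp I is
   represented by a map (I -> R) -> (I -> R) of which only the values on the
   cone matter. The order (_ <= _)%O, the addition and the scaling on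
   functions I -> R are the pointwise ones of the library. *)

Section ComparisonFunctions.
Variable R : realType.
Implicit Type g : R -> R.

Definition classK g : Prop :=
  [/\ {within `[0, +oo[, continuous g},
      (forall r s : R, 0 <= r -> r < s -> g r < g s) &
      g 0 = 0].

Definition classKoo g : Prop :=
  classK g /\ (forall M : R, exists2 r, 0 <= r & M < g r).

Definition zero_gain g : Prop := forall r : R, 0 <= r -> g r = 0.

Definition gain g : Prop := classK g \/ zero_gain g.

Definition linear_gain g : Prop :=
  exists2 c : R, 0 <= c & forall r : R, 0 <= r -> g r = c * r.

End ComparisonFunctions.

Section SequenceSpace.
Variables (R : realType) (I : Type).
Implicit Type s : I -> R.

Definition linf : set (I -> R) := [set s | bounded_fun s].

(* Meaningful for s in linf only, as sup is 0 on unbounded sets. *)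
Definition linf_norm s : R := sup (range (fun i => `|s i|)).

Definition linfp : set (I -> R) := [set s | linf s /\ forall i, 0 <= s i].

(* Interior relative to the normed space (linf, linf_norm). *)
Definition linf_interior (P : set (I -> R)) : set (I -> R) :=
  [set s | linf s /\ exists2 e : R, 0 < e &
     forall t, linf t -> linf_norm (t - s) < e -> P t].

End SequenceSpace.

Arguments linf {R I}.
Arguments linfp {R I}.

Section GainOperator.
Variables (R : realType) (I : Type) (gam : I -> I -> R -> R).

Definition gain_op (s : I -> R) : I -> R :=
  fun i => sup (range (fun j => gam i j (s j))).

(* The suprema defining gain_op s must be finite, besides gain_op s being
   bounded, since sup is 0 on unbounded sets. *)
Definition gain_op_well_defined : Prop :=
  forall s, linfp s ->
    (forall i, has_ubound (range (fun j => gam i j (s j)))) /\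
    linfp (gain_op s).

End GainOperator.

Section Operators.
Variables (R : realType) (I : Type).
Variable A : (I -> R) -> (I -> R).

Definition MBI_id_minus : Prop :=
  exists2 xi : R -> R, classKoo xi &
    forall v w, linfp v -> linfp w ->
      (v - A v <= w)%O -> linf_norm v <= xi (linf_norm w).

Definition strict_decay_point : Prop :=
  exists lam : R, exists s0 : I -> R,
    [/\ 0 < lam, lam < 1, linf_interior linfp s0 & (A s0 <= lam *: s0)%O].

Definition radius_seq (n : nat) : R :=
  sup [set linf_norm (iter n A s) `^ (n%:R)^-1
      | s in [set s | linfp s /\ linf_norm s = 1]].

Definition radius_seq1 (n : nat) : R :=
  linf_norm (iter n A (cst 1)) `^ (n%:R)^-1.

(* The spectral radius of a positively homogeneous monotone operator is defined
   by the limit of radius_seq; limn is total, so convergence is required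
   explicitly in spectral_radius_lt1. *)
Definition spectral_radius : R := limn radius_seq.

Definition spectral_radius_lt1 : Prop :=
  [/\ radius_seq @ \oo --> spectral_radius,
      radius_seq1 @ \oo --> spectral_radius &
      spectral_radius < 1].

Definition input (u : nat -> I -> R) : Prop :=
  (forall k, linfp (u k)) /\ has_ubound (range (fun k => linf_norm (u k))).

Definition input_norm (u : nat -> I -> R) : R :=
  sup (range (fun k => linf_norm (u k))).

Definition solution (u x : nat -> I -> R) : Prop :=
  (forall k, linfp (x k)) /\ (forall k, (x k.+1 <= A (x k) + u k)%O).

Definition eISS : Prop :=
  exists M a : R, exists gamma : R -> R,
    [/\ 1 <= M, 0 < a, a < 1, classKoo gamma &
      forall u x, input u -> solution u x -> forall k : nat,
        linf_norm (x k) <= M * linf_norm (x 0%N) * a ^+ k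
                           + gamma (input_norm u)].

Definition MLIM : Prop :=
  exists2 xi : R -> R, classKoo xi &
    forall (eps : R) (w : I -> R) (x : nat -> I -> R),
      0 < eps -> linfp w -> solution (fun=> w) x ->
      (forall k, (x k.+1 <= x k)%O) ->
      exists N : nat, linf_norm (x N) <= eps + xi (linf_norm w).

End Operators.

(* Main.v *)
Require Import Defs.
From mathcomp Require Import ring lra.

(* Linear gains make the gain operator A monotone, positively homogeneous and
   subadditive on the cone. For such an A, all five properties amount to
   exponential decay |A^n 1| <= K q^n with q < 1.
   MBI gives the decay through the recursion y_0 = 1, y_(n+1) = 1 + (1 + e) A y_n:
   it dominates (1 + e)^n A^n 1, and y_n - A y_n <= 1 + e A y_n, so that for small
   e the linear MBI bound is self-improving and keeps y_n bounded. Conversely,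
   decay yields the point s0 = \sum_(k < N) p^k A^k 1 with p > 1, and eISS by
   iterating the inequality. Finally MLIM implies MBI, because v - A v <= w says
   that v is a constant solution for the input w. *)

Set Implicit Arguments.
Unset Strict Implicit.
Unset Printing Implicit Defensive.

Local Open Scope classical_set_scope.
Local Open Scope ring_scope.

(** * The supremum norm on bounded functions and on the nonnegative cone *)

Section SupNorm.
Variables (R : realType) (I : Type).
Implicit Types s t : I -> R.

Lemma linf_bounded s C : (forall i, `|s i| <= C) -> linf s.
Proof.
move=> sC; exists C; split; first exact: num_real.
by move=> x Cx i _; exact: le_trans (sC i) (ltW Cx).
Qed.

Lemma linfp_bounded s C : (forall i, 0 <= s i <= C) -> linfp s.
Proof.
move=> sC; split; last by move=> i; case/andP: (sC i).
by apply: (@linf_bounded _ C) => i; case/andP: (sC i) => s0 ?; rewrite ger0_norm.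
Qed.

Lemma le_linf_norm s i : linf s -> `|s i| <= linf_norm s.
Proof.
move=> [M [_ sM]]; apply: ub_le_sup; last by exists i.
by exists (M + 1) => _ [j _ <-]; apply: sM => //; rewrite ltrDl.
Qed.

(** The condition [0 <= C] covers an empty [I], where the supremum takes its default value 0. *)
Lemma linf_norm_le s C : 0 <= C -> (forall i, `|s i| <= C) -> linf_norm s <= C.
Proof.
move=> C0 sC; rewrite /linf_norm.
have [->|] := eqVneq (range (fun i => `|s i|)) set0; first by rewrite sup0.
by move=> /set0P ne; apply: ge_sup => // _ [i _ <-].
Qed.

(** This holds for unbounded [s] too, since [sup] then returns 0. *)
Lemma linf_norm_ge0 s : 0 <= linf_norm s.
Proof.
have [[_ [i _ _]]|] := pselect (range (fun i => `|s i|) !=set0); last first.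
  by move=> /nonemptyPn E; rewrite /linf_norm E sup0.
have [ub|nub] := pselect (has_ubound (range (fun i => `|s i|))).
  by apply: le_trans (ub_le_sup ub _); last by exists i.
by rewrite /linf_norm sup_out // => -[].
Qed.

Lemma linfp_ge0 s i : linfp s -> 0 <= s i.
Proof. by case. Qed.

Lemma linfp_le_norm s i : linfp s -> s i <= linf_norm s.
Proof. by move=> [sb s0]; rewrite -[leLHS]ger0_norm //; exact: le_linf_norm. Qed.

Lemma linfp_norm_le s C : linfp s -> 0 <= C -> (forall i, s i <= C) ->
  linf_norm s <= C.
Proof.
by move=> [_ s0] C0 sC; apply: linf_norm_le => // i; rewrite ger0_norm.
Qed.

Lemma linfp_cst c : 0 <= c -> linfp (cst c : I -> R).
Proof. by move=> c0; apply: (@linfp_bounded _ c) => i /=; rewrite c0 lexx. Qed.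

Lemma linfp_add s t : linfp s -> linfp t -> linfp (s + t).
Proof.
move=> sp tp; apply: (@linfp_bounded _ (linf_norm s + linf_norm t)) => i.
by rewrite addr_ge0 ?linfp_ge0 //= lerD ?linfp_le_norm.
Qed.

Lemma linfp_scale c s : 0 <= c -> linfp s -> linfp (c *: s).
Proof.
move=> c0 sp; apply: (@linfp_bounded _ (c * linf_norm s)) => i.
apply/andP; split; first exact: mulr_ge0 c0 (linfp_ge0 _ _).
by apply: ler_wpM2l => //; exact: linfp_le_norm.
Qed.

Lemma linf_norm_mono s t : linfp s -> linfp t -> (s <= t)%O ->
  linf_norm s <= linf_norm t.
Proof.
move=> sp tp /lefP st; apply: linfp_norm_le (linf_norm_ge0 _) _ => // i.
exact: le_trans (st i) (linfp_le_norm _ _).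
Qed.

(** The inequality [norm_le] is used twice: for [c], and for [c^-1] applied to [c *: s]. *)
Lemma linf_norm_scale c s : 0 <= c -> linfp s ->
  linf_norm (c *: s) = c * linf_norm s.
Proof.
have norm_le d t : 0 <= d -> linfp t -> linf_norm (d *: t) <= d * linf_norm t.
  move=> d0 tp; apply: linfp_norm_le; [exact: linfp_scale| |move=> i].
    by rewrite mulr_ge0 ?linf_norm_ge0.
  by apply: ler_wpM2l => //; exact: linfp_le_norm.
move=> c0 sp; apply/eqP; rewrite eq_le norm_le //=.
have [->|cn0] := eqVneq c 0; first by rewrite mul0r linf_norm_ge0.
have cp : 0 < c by rewrite lt0r cn0.
rewrite mulrC -ler_pdivlMr // mulrC -[in leLHS](scalerK cn0 s).
by apply: norm_le; [rewrite invr_ge0|exact: linfp_scale].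
Qed.

Lemma linf_norm_cst c : inhabited I -> 0 <= c -> linf_norm (cst c : I -> R) = c.
Proof.
move=> [i] c0; apply/eqP; rewrite eq_le; apply/andP; split.
  by apply: linf_norm_le => // j; rewrite ger0_norm.
exact: (@linfp_le_norm _ i (linfp_cst c0)).
Qed.

End SupNorm.

(** * Growth rates of submultiplicative sequences *)

Section Submultiplicative.
Variables (R : realType) (a : nat -> R).
Hypothesis a_ge0 : forall n, 0 <= a n.
Hypothesis a_mul : forall m n, a (m + n)%N <= a m * a n.

(** Division of [n] by [N] splits [a n] into full blocks, each costing [q ^+ N], and a remainder
    below [N]; the sum [K] bounds the finitely many remainder terms. *)
Lemma submul_geometric N q : (0 < N)%N -> 0 < q -> a N <= q ^+ N ->
  exists K, 0 <= K /\ forall n, a n <= K * q ^+ n.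
Proof.
move=> N0 q0 aN; pose K := \sum_(k < N) a k / q ^+ k.
(* The factor [Num.max (a 0) 1] pays for the case [m = 0], as [a 0] may exceed 1. *)
have aq m : a (N * m)%N <= q ^+ (N * m) * Num.max (a 0) 1.
  elim: m => [|m IH]; first by rewrite muln0 expr0 mul1r le_max lexx.
  rewrite mulnS exprD -mulrA; apply: le_trans (a_mul _ _) _.
  by apply: ler_pM.
have K0 k : 0 <= a k / q ^+ k by rewrite divr_ge0 // exprn_ge0 // ltW.
exists (Num.max (a 0) 1 * K); split.
  by rewrite mulr_ge0 ?sumr_ge0 // le_max ler01 orbT.
move=> n; rewrite {1 2}(divn_eq n N) mulnC exprD.
apply: le_trans (a_mul _ _) _; set p := (n %% N)%N.
have pK : a p <= K * q ^+ p.
  have pN : (p < N)%N by rewrite ltn_pmod.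
  rewrite -ler_pdivrMr ?exprn_gt0 // /K (bigD1 (Ordinal pN)) //=.
  by rewrite lerDl sumr_ge0.
apply: le_trans (ler_pM _ _ (aq _) pK) _ => //.
by rewrite le_eqVlt; apply/orP; left; apply/eqP; ring.
Qed.

Lemma cvg_root_cst (K : R) : 0 < K -> K `^ (n%:R)^-1 @[n --> \oo] --> (1 : R).
Proof.
move=> K0.
have -> : (fun n : nat => K `^ (n%:R)^-1) = (fun n : nat => expR (n%:R^-1 * ln K)).
  by apply/funext => n; rewrite /powR gt_eqF.
rewrite -[X in _ --> X]expR0; apply: continuous_cvg; first exact: continuous_expR.
rewrite -[X in _ --> X](mul0r (ln K)); apply: cvgM (cvg_cst _).
(* [cvg_harmonic] concerns the inverses of [n.+1], hence the shift. *)
rewrite -(cvg_shiftS (fun n : nat => (n%:R : R)^-1)).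
exact: cvg_harmonic.
Qed.

(* Fekete's lemma *)
Lemma cvg_submul_root :
  exists2 r, 0 <= r /\ (forall n, (0 < n)%N -> r <= a n `^ (n%:R)^-1) &
    a n `^ (n%:R)^-1 @[n --> \oo] --> r.
Proof.
(* The limit will be the infimum of [S]. Index 0 is excluded: [0^-1 = 0] makes [b 0 = 1] whatever
   [a] is. *)
pose b n := a n `^ (n%:R)^-1; pose S := [set b n | n in [set n | (0 < n)%N]].
have S0 : S !=set0 by exists (b 1%N), 1%N.
have lbS : lbound S 0 by move=> _ [n _ <-]; exact: powR_ge0.
have hS : has_inf S by split => //; exists 0.
have rb n : (0 < n)%N -> inf S <= b n.
  by move=> n0; apply: ge_inf; [case: hS|exists n].
exists (inf S); first by split => //; exact: lb_le_inf.
apply/cvgrPdist_lt => e e0.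
have [_ [N /= N0 <-] bN] := inf_adherent (divr_gt0 e0 (ltr0n R 2)) hS.
set r := inf S in rb bN *.
have r0 : 0 <= r by exact: lb_le_inf.
(* Some root [b N] lies below [q], so the single index [N] yields a geometric bound of rate [q] for
   all [n]. *)
pose q := r + e / 2; have q0 : 0 < q by rewrite /q; lra.
have aN : a N <= q ^+ N.
  have -> : a N = b N ^+ N.
    by rewrite -powR_mulrn ?powR_ge0 // -powRrM mulVf ?powRr1 // pnatr_eq0 -lt0n.
  by rewrite ler_pXn2r // ?nnegrE ?powR_ge0 // ltW.
have [K [K0 aK]] := submul_geometric N0 q0 aN.
(* This upper bound for [b n] tends to [q], which leaves [e / 2] to spare; [K + 1] replaces [K],
   which may be 0. *)
have : (K + 1) `^ (n%:R)^-1 * q @[n --> \oo] --> 1 * q.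
  by apply: cvgM (cvg_cst _); apply: cvg_root_cst; lra.
rewrite mul1r => /cvgrPdist_lt /(_ (e / 2)) /(_ ltac:(lra)) H.
near=> n.
have n0 : (0 < n)%N by near: n; exact: nbhs_infty_gt.
have bn : b n <= (K + 1) `^ (n%:R)^-1 * q.
  have -> : q = (q ^+ n) `^ (n%:R)^-1.
    rewrite -powR_mulrn ?(ltW q0) // -powRrM mulfV ?powRr1 ?(ltW q0) //.
    by rewrite pnatr_eq0 -lt0n.
  rewrite -powRM; [|lra|by rewrite exprn_ge0 ?ltW].
  rewrite ge0_ler_powR ?nnegrE ?invr_ge0 //.
    by rewrite mulr_ge0 ?exprn_ge0 ?(ltW q0) //; lra.
  apply: le_trans (aK n) _; rewrite ler_wpM2r ?exprn_ge0 ?(ltW q0) //; lra.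
have := rb _ n0; rewrite -/(b n).
have : `|q - (K + 1) `^ (n%:R)^-1 * q| < e / 2 by near: n; exact: H.
rewrite /q in bn *; rewrite !ltr_norml; lra.
Unshelve. all: by end_near.
Qed.

End Submultiplicative.

(** * Monotone, homogeneous, subadditive operators on the cone *)

Section MonotoneSublinear.
Variables (R : realType) (I : Type) (A : (I -> R) -> (I -> R)).
Hypothesis I_inh : inhabited I.
Hypothesis A_linfp : forall s, linfp s -> linfp (A s).
Hypothesis A_mono : forall s t, linfp s -> linfp t ->
  (s <= t)%O -> (A s <= A t)%O.
Hypothesis A_add : forall s t, linfp s -> linfp t -> (A (s + t) <= A s + A t)%O.
Hypothesis A_scale : forall (c : R) s, 0 <= c -> linfp s ->
  A (c *: s) = c *: A s.

Let one : I -> R := cst 1.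
Let norm1 n := linf_norm (iter n A one).

(** Testing the vector 1 is enough: by [linf_norm_iter_le] it controls the iterates of every element
    of the cone. *)
Definition exponential_decay : Prop :=
  exists K q : R, [/\ 0 <= K, 0 < q, q < 1 &
    forall n, linf_norm (iter n A (cst 1)) <= K * q ^+ n].

Let one_linfp : linfp one. Proof. exact: linfp_cst. Qed.

Let one_norm : linf_norm one = 1. Proof. exact: linf_norm_cst. Qed.

Lemma iter_linfp n s : linfp s -> linfp (iter n A s).
Proof. by move=> sp; elim: n => //= n IH; exact: A_linfp. Qed.

Lemma iter_mono n s t : linfp s -> linfp t -> (s <= t)%O ->
  (iter n A s <= iter n A t)%O.
Proof.
by move=> sp tp st; elim: n => //= n IH; apply: A_mono => //; exact: iter_linfp.
Qed.

Lemma iter_scale n (c : R) s : 0 <= c -> linfp s ->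
  iter n A (c *: s) = c *: iter n A s.
Proof.
by move=> c0 sp; elim: n => //= n ->; rewrite A_scale //; exact: iter_linfp.
Qed.

Lemma linfp_le_scale_one s C : (forall i, s i <= C) -> (s <= C *: one)%O.
Proof. by move=> sC; apply/lefP => i; apply: le_trans (sC i) _; rewrite -[leLHS]mulr1. Qed.

(** Iterate [A] on [s <= |s| 1], by monotonicity, and pull the scalar out by homogeneity. *)
Lemma iter_le_norm n s : linfp s ->
  (iter n A s <= linf_norm s *: iter n A one)%O.
Proof.
move=> sp; rewrite -iter_scale ?linf_norm_ge0 //.
apply: iter_mono => //; first by apply: linfp_scale; rewrite ?linf_norm_ge0.
by apply: linfp_le_scale_one => i; exact: linfp_le_norm.
Qed.

Lemma linf_norm_iter_le n s : linfp s ->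
  linf_norm (iter n A s) <= linf_norm s * norm1 n.
Proof.
move=> sp; have p1 : linfp (iter n A one) by exact: iter_linfp.
rewrite -linf_norm_scale ?linf_norm_ge0 //.
apply: linf_norm_mono; [exact: iter_linfp| |exact: iter_le_norm].
by apply: linfp_scale => //; exact: linf_norm_ge0.
Qed.

(** The previous bound at the vector [A^m 1]; this makes the results on submultiplicative sequences
    applicable to [norm1]. *)
Lemma linf_norm_iter_mul m n : norm1 (m + n) <= norm1 m * norm1 n.
Proof.
rewrite /norm1 addnC iterD; apply: linf_norm_iter_le; exact: iter_linfp.
Qed.

(* Homogeneity makes the MBI bound linear in the scalar bound on [v - A v]. *)
Lemma MBI_linear : MBI_id_minus A ->
  exists2 c : R, 0 < c & forall v (W : R), linfp v -> 0 < W ->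
    (v <= A v + W *: one)%O -> linf_norm v <= c * W.
Proof.
move=> [xi [[_ xi_mono xi0] _] mbi]; exists (xi 1).
  by rewrite -xi0; apply: xi_mono.
move=> v W vp W0 /lefP vW.
have W'0 : 0 <= W^-1 by rewrite invr_ge0 ltW.
have zp : linfp (W^-1 *: v) by exact: linfp_scale.
have : linf_norm (W^-1 *: v) <= xi (linf_norm one).
  apply: mbi => //; apply/lefP => i; rewrite A_scale //.
  have := vW i.
  change (v i <= A v i + W * 1 -> W^-1 * v i - W^-1 * A v i <= 1).
  by move=> vWi; rewrite -mulrBr mulrC ler_pdivrMr //; lra.
by rewrite one_norm linf_norm_scale // mulrC ler_pdivrMr.
Qed.

Lemma MBI_decay : MBI_id_minus A -> exponential_decay.
Proof.
move=> /MBI_linear [c c0 mbi].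
have C0 : 0 <= norm1 1 by exact: linf_norm_ge0.
set C := norm1 1 in C0.
(* Chosen so that [c * (e * C) <= 1 / 2]; the [+ 1] keeps the denominator positive when [C = 0]. *)
pose e := (2 * (c * C + 1))^-1.
have cC0 : 0 <= c * C by rewrite mulr_ge0 // ltW.
have e0 : 0 < e by rewrite invr_gt0; lra.
have ecC : c * (e * C) <= 2^-1.
  have -> : c * (e * C) = (c * C) / (2 * (c * C + 1)) by rewrite /e; ring.
  by rewrite ler_pdivrMr; lra.
have e1 : 0 <= 1 + e by lra.
pose B s := (1 + e) *: A s.
(* [y n <= 1 + B (y n)] because [y] increases, so MBI bounds [y n];
   moreover [B^n 1 <= y n]. *)
pose y n := iter n (fun s => one + B s) one.
have Bp s : linfp s -> linfp (B s) by move=> sp; apply: linfp_scale => //; exact: A_linfp.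
have yp n : linfp (y n) by elim: n => //= n IH; apply: linfp_add => //; exact: Bp.
have By s t : linfp s -> linfp t -> (s <= t)%O -> forall i, B s i <= B t i.
  by move=> sp tp st i; apply: ler_wpM2l => //; have /lefP := A_mono sp tp st.
have ymono n : (y n <= y n.+1)%O.
  elim: n => [|n IH]; apply/lefP => i.
    by rewrite -[leLHS]addr0; apply: lerD => //; exact: linfp_ge0 (Bp _ _).
  by apply: lerD => //; apply: (By _ _ (yp n) (yp n.+1) IH).
have ysub n i : y n i <= 1 + (1 + e) * A (y n) i.
  by have /lefP /(_ i) := ymono n.
(* With [W = 1 + e * C * |y n|] the bound reads [|y n| <= c + |y n| / 2], whence [2 * c]. *)
have yb n : linf_norm (y n) <= 2 * c.
  have W0 : 0 < 1 + e * C * linf_norm (y n).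
    by rewrite ltr_pwDl // !mulr_ge0 ?linf_norm_ge0 // ltW.
  have : linf_norm (y n) <= c * (1 + e * C * linf_norm (y n)).
    apply: mbi => //; apply/lefP => i.
    apply: le_trans (ysub n i) _.
    change (1 + (1 + e) * A (y n) i <= A (y n) i + (1 + e * C * linf_norm (y n)) * 1).
    have : A (y n) i <= linf_norm (y n) * C.
      apply: le_trans (@linf_norm_iter_le 1 _ (yp n)).
      exact: linfp_le_norm (A_linfp _).
    by rewrite -(ler_pM2l e0); lra.
  have := ler_wpM2r (linf_norm_ge0 (y n)) ecC; lra.
have Ay n : ((1 + e) ^+ n *: iter n A one <= y n)%O.
  elim: n => [|n IH]; first by rewrite scale1r.
  apply/lefP => i; have Anp : linfp (iter n A one) by exact: iter_linfp.
  have enp : 0 <= (1 + e) ^+ n by exact: exprn_ge0.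
  have -> : (1 + e) ^+ n.+1 *: iter n.+1 A one = B ((1 + e) ^+ n *: iter n A one).
    by rewrite /B A_scale // scalerA -exprS.
  apply: le_trans (By _ _ (linfp_scale enp Anp) (yp n) IH i) _.
  by rewrite -[leLHS]add0r; apply: lerD.
(* [Ay] and [yb] together give [(1 + e) ^+ n * |A^n 1| <= 2 * c]. *)
exists (2 * c), (1 + e)^-1; split; [lra|by rewrite invr_gt0; lra| |move=> n].
  by rewrite invf_lt1; lra.
have en0 : 0 < (1 + e) ^+ n by rewrite exprn_gt0 //; lra.
have Anp : linfp (iter n A one) by exact: iter_linfp.
rewrite exprVn ler_pdivlMr // mulrC; apply: le_trans (yb n).
have := linf_norm_mono (linfp_scale (ltW en0) Anp) (yp n) (Ay n).
by rewrite linf_norm_scale // ltW.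
Qed.

(* With [1 < p] and [p ^+ N * A^N 1 <= 1], the vector
   [s0 = \sum_(k < N) p ^+ k * A^k 1] satisfies [A s0 <= p^-1 * s0]. *)
Lemma decay_point : exponential_decay -> strict_decay_point A.
Proof.
move=> [K [q [K0 q0 q1 AK]]].
(* Here [l] is [p^-1]. Any value strictly between [q] and 1 would do: [q / l < 1] makes the weighted
   terms [l^-1 ^+ k *: A^k 1] tend to 0. *)
pose l := (q + 1) / 2; have l0 : 0 < l by rewrite /l; lra.
have l1 : l < 1 by rewrite /l; lra.
have ql : q / l < 1 by rewrite ltr_pdivrMr // /l; lra.
have [N NK] : exists N, K * (q / l) ^+ N.+1 <= 1.
  have ql0 : 0 <= q / l by rewrite divr_ge0 ?ltW.
  have : K * (q / l) ^+ n @[n --> \oo] --> K * 0.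
    apply: cvgM (cvg_cst _) _; apply: cvg_expr; first by rewrite ger0_norm.
  rewrite mulr0 => /cvgrPdist_lt /(_ 1 ltr01) [N _ NP]; exists N.
  have := NP N.+1 (leqnSn N); rewrite /= sub0r normrN => /ltW.
  by apply: le_trans; exact: ler_norm.
pose z n := \sum_(k < n) (l^-1) ^+ k *: iter k A one.
have pk0 k : 0 <= l^-1 ^+ k by rewrite exprn_ge0 // invr_ge0 ltW.
have Akp k : linfp (iter k A one) by exact: iter_linfp.
have tp k : linfp (l^-1 ^+ k *: iter k A one) by exact: linfp_scale.
have zS n : z n.+1 = z n + l^-1 ^+ n *: iter n A one by rewrite /z big_ord_recr.
have zp n : linfp (z n).
  elim: n => [|n IH]; last by rewrite zS; exact: linfp_add.
  by rewrite /z big_ord0; exact: (@linfp_cst _ _ 0).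
(* Applying [A] shifts the sum by one index at the price of a factor [l]: the term [k = 0], equal to
   1, is lost and a new last term appears. *)
have Az n i : A (z n.+1) i <= l * (z n.+1 i + l^-1 ^+ n.+1 * iter n.+1 A one i - 1).
  elim: n => [|n IH].
    rewrite /z big_ord1 expr0 scale1r.
    change (A one i <= l * (1 + l^-1 * A one i - 1)).
    by rewrite addrAC subrr add0r mulVKf ?gt_eqF.
  rewrite zS; have /lefP /(_ i) := A_add (zp n.+1) (tp n.+1).
  move=> /le_trans; apply; rewrite A_scale //.
  change (A (z n.+1) i + l^-1 ^+ n.+1 * iter n.+2 A one i <=
    l * (z n.+1 i + l^-1 ^+ n.+1 * iter n.+1 A one i +
      l^-1 ^+ n.+2 * iter n.+2 A one i - 1)).
  have -> : l^-1 ^+ n.+1 * iter n.+2 A one i =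
      l * (l^-1 ^+ n.+2 * iter n.+2 A one i).
    by rewrite [in RHS]exprS -mulrA mulVKf ?gt_eqF.
  lra.
(* The summand [k = 0] keeps [z n.+1] above 1, so the open ball of radius 1 around it lies in the
   cone. *)
have z1 n i : 1 <= z n.+1 i.
  elim: n => [|n IH]; first by rewrite /z big_ord1 expr0 scale1r.
  by rewrite zS -[leLHS]addr0; apply: lerD => //; exact: linfp_ge0 (tp _).
exists l, (z N.+1); split => //.
  split; first by case: (zp N.+1).
  exists 1 => // t tb tz; split => // i.
  have dp : linf (t - z N.+1).
    apply: (@linf_bounded _ _ _ (linf_norm t + linf_norm (z N.+1))) => i'.
    apply: le_trans (ler_normB _ _) _.
    by apply: lerD; apply: le_linf_norm => //; case: (zp N.+1).
  have := le_lt_trans (le_linf_norm i dp) tz.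
  change (`|t i - z N.+1 i| < 1 -> 0 <= t i).
  by rewrite ltr_norml; have := z1 N i; lra.
apply/lefP => i; apply: le_trans (Az N i) _.
apply: ler_wpM2l; first exact: ltW.
(* The new last term is at most [K * (q / l) ^+ N.+1 <= 1], so the lost 1 compensates for it. *)
rewrite -addrA gerDl subr_le0; apply: le_trans NK.
rewrite expr_div_n mulrA exprVn mulrC ler_wpM2r ?invr_ge0 ?exprn_ge0 ?(ltW l0) //.
by apply: le_trans (AK _); exact: linfp_le_norm.
Qed.

(** An interior point [s] is bounded below by some [e / 2 > 0]. Hence
    [e / 2 * A^n 1 <= A^n s <= l ^+ n * s]. *)
Lemma decay_point_decay : strict_decay_point A -> exponential_decay.
Proof.
move=> [l [s [l0 l1 [sb [e e0 sint]] /lefP sl]]].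
have s_ge i : e / 2 <= s i.
  (* Lowering every coordinate by [e / 2] stays in the ball of radius [e] around [s], hence in the
     cone. *)
  have : linfp (s - cst (e / 2)).
    apply: sint.
      apply: (@linf_bounded _ _ _ (linf_norm s + e / 2)) => j.
      apply: le_trans (ler_normB _ _) _; apply: lerD; first exact: le_linf_norm.
      by rewrite ger0_norm //=; lra.
    rewrite (@le_lt_trans _ _ (e / 2)) //; last lra.
    apply: linf_norm_le => [|j]; first lra.
    rewrite addrAC subrr add0r.
    by change (`|- (e / 2)| <= e / 2); rewrite normrN ger0_norm //; lra.
  by move=> [_ /(_ i)]; change (0 <= s i - e / 2 -> e / 2 <= s i); lra.
have sp : linfp s by split => // i; apply: le_trans (s_ge i); lra.
have l0' := ltW l0.
have As n : (iter n A s <= l ^+ n *: s)%O.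
  elim: n => [|n /= IH]; first by rewrite scale1r.
  have lp := linfp_scale (exprn_ge0 n l0') sp.
  have /le_trans := A_mono (iter_linfp n sp) lp IH; apply.
  rewrite A_scale ?exprn_ge0 //; apply/lefP => i; rewrite exprSr.
  change (l ^+ n * A s i <= l ^+ n * l * s i).
  by rewrite -mulrA ler_wpM2l ?exprn_ge0 //; exact: sl.
exists (2 / e * linf_norm s), l; split => //.
  by rewrite mulr_ge0 ?linf_norm_ge0 // divr_ge0 // ltW.
move=> n; apply: linfp_norm_le => [||i]; first exact: iter_linfp.
  by rewrite !mulr_ge0 ?linf_norm_ge0 ?exprn_ge0 ?invr_ge0 // ltW.
have e20 : 0 <= e / 2 by lra.
have os : ((e / 2) *: one <= s)%O.
  apply/lefP => j; change (e / 2 * 1 <= s j); rewrite mulr1; exact: s_ge.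
have /lefP /(_ i) := le_trans (iter_mono n (linfp_scale e20 one_linfp) sp os) (As n).
rewrite iter_scale //.
change (e / 2 * iter n A one i <= l ^+ n * s i ->
  iter n A one i <= 2 / e * linf_norm s * l ^+ n).
have /(ler_wpM2l (exprn_ge0 n l0')) sn := linfp_le_norm i sp.
move=> /le_trans /(_ sn).
rewrite -(invf_div e) mulrC -ler_pdivlMr ?divr_gt0 // => /le_trans; apply.
by rewrite le_eqVlt; apply/orP; left; apply/eqP; ring.
Qed.

(** * Decay and the spectral radius *)

(** The supremum is attained at [one], which has norm 1 and dominates the unit sphere of the
    cone. *)
Lemma radius_seqE n : radius_seq A n = radius_seq1 A n.
Proof.
apply/eqP; rewrite eq_le; apply/andP; split; last first.
  apply: ub_le_sup; last by exists one.
  exists (radius_seq1 A n) => _ [s [sp s1] <-].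
  apply: ge0_ler_powR; rewrite ?nnegrE ?invr_ge0 ?linf_norm_ge0 //.
  by apply: le_trans (linf_norm_iter_le n sp) _; rewrite s1 mul1r.
apply: ge_sup; first by exists (radius_seq1 A n), one.
move=> _ [s [sp s1] <-].
apply: ge0_ler_powR; rewrite ?nnegrE ?invr_ge0 ?linf_norm_ge0 //.
by apply: le_trans (linf_norm_iter_le n sp) _; rewrite s1 mul1r.
Qed.

(** The limit in Fekete's lemma lies below every root of positive index, so one index with
    [norm1 N.+1 < 1] suffices. *)
Lemma decay_radius : exponential_decay -> spectral_radius_lt1 A.
Proof.
move=> [K [q [K0 q0 q1 AK]]].
have [r [r0 r_le] r_lim] :=
  cvg_submul_root (fun n => linf_norm_ge0 (iter n A one)) linf_norm_iter_mul.
have rE : radius_seq A = radius_seq1 A by apply/funext => n; exact: radius_seqE.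
have sE : spectral_radius A = r.
  by rewrite /spectral_radius rE; apply: cvg_lim r_lim.
rewrite /spectral_radius_lt1 sE rE; split => //.
have : K * q ^+ n @[n --> \oo] --> K * 0.
  by apply: cvgM (cvg_cst _) _; apply: cvg_expr; rewrite gtr0_norm.
rewrite mulr0 => /cvgrPdist_lt /(_ 1 ltr01) [N _ NP].
have := NP N.+1 (leqnSn N); rewrite /= sub0r normrN => KN.
have AN1 : norm1 N.+1 < 1.
  exact: le_lt_trans (AK _) (le_lt_trans (ler_norm _) KN).
apply: le_lt_trans (r_le N.+1 isT) _.
have : norm1 N.+1 `^ (N.+1%:R)^-1 < 1 `^ (N.+1%:R)^-1; last by rewrite powR1.
by apply: gt0_ltr_powR; rewrite ?nnegrE ?linf_norm_ge0 ?invr_gt0.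
Qed.

(** A single root below [q], midway between the radius and 1, gives decay at all indices by
    [submul_geometric]. *)
Lemma radius_decay : spectral_radius_lt1 A -> exponential_decay.
Proof.
move=> [_ r_lim r1]; set r := spectral_radius A in r_lim r1.
have r0 : 0 <= r.
  by apply: cvgr_to_ge r_lim _; near=> n; exact: powR_ge0.
pose q := (r + 1) / 2; have q0 : 0 < q by rewrite /q; lra.
have q1 : q < 1 by rewrite /q; lra.
have /cvgrPdist_lt /(_ (q - r)) /(_ ltac:(rewrite /q; lra)) [N _ NP] := r_lim.
have := NP N.+1 (leqnSn N); rewrite /= ltr_norml => /andP[rN _].
have aN : norm1 N.+1 <= q ^+ N.+1.
  have -> : norm1 N.+1 = radius_seq1 A N.+1 ^+ N.+1.
    by rewrite -powR_mulrn ?powR_ge0 // -powRrM mulVf ?powRr1 ?linf_norm_ge0.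
  by apply: lerXn2r; rewrite ?nnegrE ?powR_ge0 ?(ltW q0) //; lra.
have [K [K0 AK]] := submul_geometric
  (fun n => linf_norm_ge0 (iter n A one)) linf_norm_iter_mul (ltn0Sn N) q0 aN.
by exists K, q.
Unshelve. all: by end_near.
Qed.

(** * Stability of the system of inequalities *)

Lemma classKoo_linear (c : R) : 0 < c -> classKoo (fun r => c * r).
Proof.
move=> c0; split; last first.
  move=> M; exists ((`|M| + 1) / c); first by rewrite divr_ge0 ?addr_ge0 ?(ltW c0).
  rewrite mulrCA mulfV ?gt_eqF // mulr1.
  by apply: le_lt_trans (ler_norm M) _; rewrite ltrDl.
split; last by rewrite mulr0.
  apply: continuous_subspaceT => x; exact: mulrl_continuous.
by move=> r s _ rs; rewrite ltr_pM2l.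
Qed.

(* Subadditivity gives [x k <= A^k (x 0) + |u| * \sum_(j < k) A^j 1]. *)
Lemma decay_eISS : exponential_decay -> eISS A.
Proof.
move=> [K [q [K0 q0 q1 AK]]].
(* Index 0 of the decay bound, where [A^0 1 = 1]. *)
have K1 : 1 <= K by have := AK 0%N; rewrite expr0 mulr1 /= one_norm.
have g0 : 0 < K / (1 - q) by rewrite divr_gt0; lra.
exists K, q, (fun r => K / (1 - q) * r); split => //.
  exact: classKoo_linear.
move=> u x [up ub] [xp xS] k; set U := input_norm u.
have uU j : linf_norm (u j) <= U by apply: ub_le_sup => //; exists j.
have U0 : 0 <= U := le_trans (linf_norm_ge0 _) (uU 0%N).
pose z n := \sum_(j < n) iter j A one.
have Akp s j : linfp s -> linfp (iter j A s) by exact: iter_linfp.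
have zS n : z n.+1 = z n + iter n A one by rewrite /z big_ord_recr.
have zp n : linfp (z n).
  elim: n => [|n IH]; last by rewrite zS; apply: linfp_add => //; exact: Akp.
  by rewrite /z big_ord0; exact: (@linfp_cst _ _ 0).
have Uzp n : linfp (U *: z n) by exact: linfp_scale.
(* The same index shift as for the decay point, without weights; the base case uses [A 0 = 0], which
   is homogeneity with factor 0. *)
have Az n i : A (z n) i + 1 <= z n.+1 i.
  elim: n => [|n IH].
    rewrite /z big_ord0 big_ord1 -(scale0r one) A_scale //.
    by change (0 * A one i + 1 <= 1); rewrite mul0r add0r.
  have /lefP /(_ i) := A_add (zp n) (Akp _ n one_linfp).
  rewrite -zS (zS n.+1).
  change (A (z n.+1) i <= A (z n) i + iter n.+1 A one i ->
    A (z n.+1) i + 1 <= z n.+1 i + iter n.+1 A one i).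
  lra.
have xz n i : x n i <= iter n A (x 0%N) i + U * z n i.
  elim: n i => [|n IH] i.
    by rewrite /z big_ord0; change (x 0%N i <= x 0%N i + U * 0); rewrite mulr0 addr0.
  have xAp : linfp (iter n A (x 0%N)) by exact: Akp.
  have /lefP /(_ i) h1 := xS n.
  have /lefP /(_ i) h2 : (A (x n) <= A (iter n A (x 0%N) + U *: z n))%O.
    by apply: A_mono => //; [exact: linfp_add|apply/lefP; exact: IH].
  have /lefP /(_ i) h3 := A_add xAp (Uzp n).
  rewrite A_scale // in h3.
  have h4 := le_trans (linfp_le_norm i (up n)) (uU n).
  have h5 := ler_wpM2l U0 (Az n i).
  move: h1 h3; rewrite iterS.
  change (x n.+1 i <= A (x n) i + u n i ->
    A (iter n A (x 0%N) + U *: z n) i <= A (iter n A (x 0%N)) i + U * A (z n) i ->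
    x n.+1 i <= A (iter n A (x 0%N)) i + U * z n.+1 i).
  lra.
(* The factor [1 - q ^+ n] is that of the exact geometric sum and lets the induction close; [zb]
   drops it. *)
have znorm n : linf_norm (z n) <= K / (1 - q) * (1 - q ^+ n).
  have q10 : 0 < 1 - q by lra.
  apply: linfp_norm_le => // [|i].
    by rewrite mulr_ge0 ?(ltW g0) // subr_ge0 exprn_ile1 ?ltW.
  elim: n => [|n IH]; first by rewrite /z big_ord0 expr0 subrr mulr0.
  rewrite zS; have h := le_trans (linfp_le_norm i (Akp _ n one_linfp)) (AK n).
  have -> : K / (1 - q) * (1 - q ^+ n.+1) = K / (1 - q) * (1 - q ^+ n) + K * q ^+ n.
    by rewrite exprS; field; rewrite gt_eqF.
  exact: lerD.
have zb : linf_norm (z k) <= K / (1 - q).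
  apply: le_trans (znorm k) _; rewrite -[leRHS]mulr1 ler_wpM2l ?(ltW g0) //.
  by rewrite gerBl exprn_ge0 ?ltW.
apply: linfp_norm_le => // [|i].
  rewrite addr_ge0 ?(mulr_ge0 (ltW g0)) // mulr_ge0 ?exprn_ge0 ?(ltW q0) //.
  by rewrite mulr_ge0 ?linf_norm_ge0.
apply: le_trans (xz k i) _; apply: lerD.
  apply: le_trans (linfp_le_norm i (Akp _ k (xp 0%N))) _.
  apply: le_trans (linf_norm_iter_le k (xp 0%N)) _.
  by rewrite [K * _]mulrC -mulrA; apply: ler_wpM2l (linf_norm_ge0 _) _ _ (AK k).
rewrite mulrC ler_wpM2r //; exact: le_trans (linfp_le_norm i (zp k)) zb.
Qed.

(** The transient term tends to 0, and a constant input [w] has [input_norm] equal to [|w|], so the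
    same gain serves. *)
Lemma eISS_MLIM : eISS A -> MLIM A.
Proof.
move=> [M [a [g [M1 a0 a1 gK H]]]]; exists g => // e w x e0 wp xs _.
have rw : range (fun _ : nat => linf_norm w) = [set linf_norm w].
  by apply/seteqP; split => [_ [? _ <-]//|_ ->]; exists 0%N.
have uw : input (fun=> w).
  by split => //; rewrite rw; exists (linf_norm w) => _ ->.
have : M * linf_norm (x 0%N) * a ^+ n @[n --> \oo] --> M * linf_norm (x 0%N) * 0.
  by apply: cvgM (cvg_cst _) _; apply: cvg_expr; rewrite gtr0_norm.
rewrite mulr0 => /cvgrPdist_lt /(_ e e0) [N _ /(_ N (leqnn N))].
rewrite /= sub0r normrN => h; exists N.
have := H _ _ uw xs N; rewrite /input_norm rw sup1 => /le_trans; apply.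
by rewrite lerD2r; apply: le_trans (ler_norm _) (ltW h).
Qed.

(** The constant solution [v] is decreasing by reflexivity; as [eps] is arbitrary, it disappears
    from the bound. *)
Lemma MLIM_MBI : MLIM A -> MBI_id_minus A.
Proof.
move=> [xi xiK H]; exists xi => // v w vp wp /lefP vw.
apply/ler_addgt0Pl => e e0.
have vs : solution A (fun=> w) (fun=> v).
  split => // _; apply/lefP => i; have := vw i.
  by change (v i - A v i <= w i -> v i <= A v i + w i); lra.
by have [] := H e w (fun=> v) e0 wp vs (fun=> lexx _).
Qed.

End MonotoneSublinear.

(** * Gain operators with linear gains *)

Section LinearGains.
Variables (R : realType) (I : Type) (gam : I -> I -> R -> R).
Hypothesis I_inh : inhabited I.
Hypothesis gam_linear : forall i j, linear_gain (gam i j).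
Hypothesis gam_wd : gain_op_well_defined gam.

Lemma gain_op_ub s i j : linfp s -> gam i j (s j) <= gain_op gam s i.
Proof. by move=> sp; apply: ub_le_sup; [case: (gam_wd sp)|exists j]. Qed.

Lemma gain_op_le s i C : (forall j, gam i j (s j) <= C) -> gain_op gam s i <= C.
Proof.
case: I_inh => i0 sC; apply: ge_sup; first by exists (gam i i0 (s i0)), i0.
by move=> _ [j _ <-].
Qed.

Lemma gain_op_linfp s : linfp s -> linfp (gain_op gam s).
Proof. by move=> /gam_wd[]. Qed.

Lemma gain_op_mono s t : linfp s -> linfp t -> (s <= t)%O ->
  (gain_op gam s <= gain_op gam t)%O.
Proof.
move=> sp tp /lefP st; apply/lefP => i; apply: gain_op_le => j.
apply: le_trans (gain_op_ub i j tp); have [c c0 gc] := gam_linear i j.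
by rewrite !gc ?linfp_ge0 // ler_wpM2l.
Qed.

(** Linear gains are additive, and a supremum of sums is at most the sum of the suprema. *)
Lemma gain_op_add s t : linfp s -> linfp t ->
  (gain_op gam (s + t) <= gain_op gam s + gain_op gam t)%O.
Proof.
move=> sp tp; apply/lefP => i; apply: gain_op_le => j.
apply: le_trans (lerD (gain_op_ub i j sp) (gain_op_ub i j tp)).
have [c c0 gc] := gam_linear i j; change ((s + t) j) with (s j + t j).
by rewrite !gc ?addr_ge0 ?linfp_ge0 // mulrDr.
Qed.

(** As for the norm, [le_scale] is used for [c] and for [c^-1]; at [c = 0] the reverse inequality is
    nonnegativity. *)
Lemma gain_op_scale (c : R) s : 0 <= c -> linfp s ->
  gain_op gam (c *: s) = c *: gain_op gam s.
Proof.
have le_scale (d : R) t : 0 <= d -> linfp t ->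
    forall i, gain_op gam (d *: t) i <= d * gain_op gam t i.
  move=> d0 tp i; apply: gain_op_le => j.
  apply: le_trans (ler_wpM2l d0 (gain_op_ub i j tp)).
  have [b b0 gb] := gam_linear i j; change ((d *: t) j) with (d * t j).
  by rewrite !gb ?mulr_ge0 ?linfp_ge0 // mulrCA.
move=> c0 sp; apply/funext => i; apply/eqP; rewrite eq_le; apply/andP; split.
  exact: le_scale.
change (c * gain_op gam s i <= gain_op gam (c *: s) i).
have csp := linfp_scale c0 sp.
have [->|cn0] := eqVneq c 0.
  by rewrite mul0r; apply: linfp_ge0; apply/gain_op_linfp/linfp_scale.
have cp : 0 < c by rewrite lt0r cn0.
rewrite mulrC -ler_pdivlMr // mulrC -[in leLHS](scalerK cn0 s).
by apply: le_scale; rewrite ?invr_ge0.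
Qed.

End LinearGains.

Theorem proposition7p17 (R : realType) (I : Type) (gam : I -> I -> R -> R)
    (I_nonempty : inhabited I)
    (gam_gain : forall i j, gain (gam i j))
    (gam_diag : forall i, zero_gain (gam i i))
    (gam_linear : forall i j, linear_gain (gam i j))
    (gam_wd : gain_op_well_defined gam) :
  [<-> MBI_id_minus (gain_op gam);
       strict_decay_point (gain_op gam);
       spectral_radius_lt1 (gain_op gam);
       eISS (gain_op gam);
       MLIM (gain_op gam)].
Proof.
have Ap := gain_op_linfp gam_wd.
have Am := gain_op_mono I_nonempty gam_linear gam_wd.
have Aa := gain_op_add I_nonempty gam_linear gam_wd.
have As := gain_op_scale I_nonempty gam_linear gam_wd.
(* A cycle of five implications; the first three pass through [exponential_decay]. *)
tfae.
- by move=> /(MBI_decay I_nonempty Ap Am As); exact: decay_point.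
- by move=> /(decay_point_decay Ap Am As); exact: decay_radius.
- by move=> /(radius_decay Ap Am As); exact: decay_eISS.
- exact: eISS_MLIM.
- exact: MLIM_MBI.
Qed.
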